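(* Consider the Hamiltonian $$H(x,y,u,v)=\omega\cdot y+\frac13u^3+\frac13v^3+\varepsilon^2u,\qquad x\in\mathbb T^1,\ y\in\mathbb R^1,\ (u,v)\in\mathbb R^1\times\mathbb R^1,$$ where $\varepsilon>0$ and $\varepsilon^2u$ is regarded as a perturbation term. Assume that $\omega$ satisfies the Diophantine condition $$|\langle k,\omega\rangle|>\frac{\gamma}{|k|^\tau},\qquad k\in\mathbb Z^n\setminus\{0\},$$ with $n=1$, $\gamma>0$ and $\tau>n-1$. Then the Hamiltonian system with Hamiltonian $H$ does not admit any lower-dimensional (invariant) torus.
   Context: The phase space $\mathbb T^1\times\mathbb R^1\times\mathbb R^1\times\mathbb R^1$ carries the standard symplectic structure, so the equations of motion are $\dot x=\partial_yH$, $\dot y=-\partial_xH$, $\dot u=\partial_vH$, $\dot v=-\partial_uH$. A lower-dimensional torus means an invariant torus of the flow whose dimension is the number of angle variables $x$ (here $1$), less than half the dimension of the phase space. *)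

(* Defs.v *)
From mathcomp Require Import all_boot all_order all_algebra generic_quotient.
From mathcomp Require Import all_classical all_reals all_analysis.

Set Implicit Arguments.
Unset Strict Implicit.
Unset Printing Implicit Defensive.

Import Order.TTheory GRing.Theory Num.Theory.
Import numFieldNormedType.Exports.

Local Open Scope classical_set_scope.
Local Open Scope quotient_scope.
Local Open Scope ring_scope.

Section Torus.
Variable R : realType.

Definition eqmodZ (x y : R) : bool := x - y \is a Num.int.

Lemma eqmodZ_refl : reflexive eqmodZ.
Proof. by move=> x; rewrite /eqmodZ subrr rpred0. Qed.

Lemma eqmodZ_sym : symmetric eqmodZ.
Proof. by move=> x y; rewrite /eqmodZ -(opprB y x) rpredN. Qed.

Lemma eqmodZ_trans : transitive eqmodZ.
Proof. by move=> y x z xy yz; rewrite /eqmodZ -(subrKA y); exact: rpredD. Qed.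

Canonical eqmodZ_equiv := EquivRel eqmodZ eqmodZ_refl eqmodZ_sym eqmodZ_trans.

(* T^1 = R / Z with the quotient topology. *)
Definition torus1 : topologicalType := quotient_topology {eq_quot eqmodZ}.

Definition torus_proj (x : R) : torus1 := \pi_{eq_quot eqmodZ} x.

(* Points are written (x, y, u, v). *)
Definition phase_space : topologicalType := (torus1 * R * R * R)%type.

End Torus.

Section HamiltonianSystem.
Variable R : realType.
Implicit Types (H : phase_space R -> R) (c : R -> phase_space R)
  (M : set (phase_space R)).

(* The partial derivatives of H at (x mod 1, y, u, v), in terms of a lift
   x : R of the angle. *)
Definition dHdx H (x y u v : R) : R :=
  derive1 (fun s : R => H (torus_proj s, y, u, v)) x.
Definition dHdy H (x y u v : R) : R :=
  derive1 (fun s : R => H (torus_proj x, s, u, v)) y.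
Definition dHdu H (x y u v : R) : R :=
  derive1 (fun s : R => H (torus_proj x, y, s, v)) u.
Definition dHdv H (x y u v : R) : R :=
  derive1 (fun s : R => H (torus_proj x, y, u, s)) v.

(* Solutions defined for all times; the angle component of c is differentiated
   through a lift x to the universal cover R of the circle. *)
Definition integral_curve H c : Prop :=
  exists x y u v : R -> R,
    (forall t, c t = (torus_proj (x t), y t, u t, v t)) /\
    (forall t : R, [/\ is_derive t 1 x (dHdy H (x t) (y t) (u t) (v t)),
                   is_derive t 1 y (- dHdx H (x t) (y t) (u t) (v t)),
                   is_derive t 1 u (dHdv H (x t) (y t) (u t) (v t)) &
                   is_derive t 1 v (- dHdu H (x t) (y t) (u t) (v t))]).

(* The flow may be incomplete: invariance of M means that the orbit of every
   point of M is defined for all times and contained in M. *)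
Definition flow_invariant H M : Prop :=
  forall p, M p ->
    exists c, [/\ integral_curve H c, c 0 = p & forall t, M (c t)].

(* Since the circle is compact and the phase space is Hausdorff, a continuous
   injection of the circle is a topological embedding. Only continuity is
   required of it, and the dynamics on the torus is not prescribed, so that
   smooth or quasi-periodic invariant tori are particular cases. *)
Definition lower_dim_invariant_torus H M : Prop :=
  (exists e : torus1 R -> phase_space R,
     [/\ continuous e, injective e & range e = M]) /\
  flow_invariant H M.

(* Here n = 1, so that k ranges over the nonzero integers. *)
Definition diophantine (omega gamma tau : R) : Prop :=
  forall k : int, k != 0 ->
    gamma / (`|k%:~R| `^ tau) < `|k%:~R * omega|.

Definition hamiltonian (omega eps : R) (p : phase_space R) : R :=
  let: (x, y, u, v) := p in
  omega * y + 3^-1 * u ^+ 3 + 3^-1 * v ^+ 3 + eps ^+ 2 * u.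

End HamiltonianSystem.

(* Main.v *)
(** Along every orbit [v' = - (u ^ 2 + eps ^ 2) <= - eps ^ 2], so [v] is strictly
    decreasing; but an invariant torus is compact, and the orbit through a
    point where [v] is minimal on it would have to leave it. *)

Require Import Defs.
From mathcomp Require Import all_boot all_order all_algebra.
From mathcomp Require Import all_classical all_reals all_analysis.
From mathcomp Require Import generic_quotient ring lra.

Import Order.TTheory GRing.Theory Num.Theory.
Import numFieldNormedType.Exports.

Local Open Scope ring_scope.

(** The circle is the image of the compact segment [[0, 1]] under the continuous quotient map. *)
Lemma torus1_compact (R : realType) : compact [set: torus1 R]%classic.
Proof.
have <- : (@torus_proj R @` `[0, 1])%classic = [set: torus1 R]%classic.
  apply/seteqP; split=> // a _.
  (* The fractional part of a representative lies in the same class modulo the integers. *)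
  exists (repr a - (Num.floor (repr a))%:~R).
    have := floor_itv (repr a); rewrite intrD /= in_itv /=; lra.
  rewrite -[RHS](reprK a); apply/eqmodP.
  by rewrite /= /eqmodZ addrAC subrr add0r rpredN intr_int.
apply: continuous_compact (@segment_compact R 0 1).
by apply: continuous_subspaceT => x; exact: pi_continuous.
Qed.

Lemma dHdu_hamiltonian (R : realType) (omega eps x y u v : R) :
  dHdu (hamiltonian omega eps) x y u v = u ^+ 2 + eps ^+ 2.
Proof.
rewrite /dHdu /hamiltonian derive1E.
under eq_fun do rewrite addrAC.
by apply: derive_val; apply: is_derive_eq; rewrite /GRing.scale /=; field.
Qed.

Lemma hamiltonian_curve_v_ub (R : realType) (omega eps t : R)
    (c : R -> phase_space R) :
  integral_curve (hamiltonian omega eps) c -> 0 < t ->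
  (c t).2 <= (c 0).2 - eps ^+ 2 * t.
Proof.
move=> [x [y [u [v [cE dc]]]]] t_gt0; rewrite !cE /=.
have dv (s : R) : is_derive s 1 v (- (u s ^+ 2 + eps ^+ 2)).
  by rewrite -(dHdu_hamiltonian _ omega eps (x s) (y s) (u s) (v s)); case: (dc s).
have cv : continuous v.
  by move=> s; apply/differentiable_continuous/derivable1_diffP; case: (dv s).
have [s _] := MVT t_gt0 (fun s _ => dv s) (continuous_subspaceT cv).
by have := mulr_ge0 (sqr_ge0 (u s)) (ltW t_gt0); lra.
Qed.

Theorem proposition2 (R : realType) (omega gamma tau eps : R)
    (eps_gt0 : 0 < eps) (gamma_gt0 : 0 < gamma) (tau_gt : 1%:R - 1 < tau)
    (omega_dioph : diophantine omega gamma tau) :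
  ~ exists M : set (phase_space R),
      lower_dim_invariant_torus (hamiltonian omega eps) M.
Proof.
move=> [M [[e [ce _ <-]] inv]].
(* Pulling [v] back along [e] lets the minimum be taken on the compact circle instead of on the
   torus in phase space. *)
have cv : continuous (fun a => (e a).2).
  by move=> a; apply: (continuous_comp (ce a)); exact: cvg_snd.
have [a _ amin] := compact_EVT_min (ex_intro _ (torus_proj 0) I)
  (@torus1_compact R) (continuous_subspaceT cv).
have [c [cc c0 cM]] := inv (e a) (ex_intro2 _ _ a I erefl).
(* Any positive time would do: by invariance [c 1] is some [e b], yet its [v] is at least [eps ^+ 2]
   below the minimum. *)
have [b _ eb] := cM 1.
have := amin b (mem_setT b).
have := hamiltonian_curve_v_ub _ _ _ _ _ cc ltr01.
rewrite c0 -eb; have := exprn_gt0 2 eps_gt0; lra.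
Qed.
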